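(* Let $X$ be a separable topological space and let $G\colon X\times X\to(0,+\infty)$ satisfy $$G(x,z)\le G(x,y)\cdot G(y,z),\quad x,y,z\in X.$$ Assume that $G$ is continuous at every point of $\Delta=\{(x,x):x\in X\}$ and equal to $1$ at every point of $\Delta$. Then $$G(a,b)=\sup\left\{\frac{f(a)}{f(b)}: f\in\mathcal{G}(G)\right\},\quad a,b\in X.$$ Conversely, for an arbitrary family $\mathcal{G}$ of functions $f\colon X\to(0,+\infty)$, every mapping $G\colon X\times X\to(0,+\infty)$ defined by $$G(a,b)=\sup\left\{\frac{f(a)}{f(b)}: f\in\mathcal{G}\right\},\quad a,b\in X$$ (that is, whenever these suprema all lie in $(0,+\infty)$), satisfies $G(x,z)\le G(x,y)\cdot G(y,z)$ for all $x,y,z\in X$, is equal to $1$ on $\Delta$, and $\mathcal{G}\subseteq\mathcal{G}(G)$.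
   Context: For a map $G\colon X\times X\to(0,+\infty)$, $$\mathcal{G}(G)=\left\{f\colon X\to(0,+\infty)\ :\ \frac{f(x)}{f(y)}\le G(x,y)\ \text{for all } x,y\in X\right\}.$$ $X\times X$ carries the product topology. A topological space is separable if it has a countable dense subset. *)

(* Defs.v *)
From mathcomp Require Import all_boot all_order all_algebra.
From mathcomp Require Import all_classical all_reals all_analysis.

Set Implicit Arguments.
Unset Strict Implicit.
Unset Printing Implicit Defensive.

Import Order.TTheory GRing.Theory Num.Theory.
Import numFieldNormedType.Exports.

Local Open Scope classical_set_scope.
Local Open Scope ring_scope.

(* Maps into (0, +oo) are represented as R-valued maps that are everywhere
   positive. *)
Definition positive_map (R : realType) (T : Type) (f : T -> R) : Prop :=
  forall x, 0 < f x.

Definition separable (X : topologicalType) : Prop :=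
  exists2 D : set X, countable D & dense D.

Definition mult_triangle (R : realType) (X : Type) (G : X * X -> R) : Prop :=
  forall x y z, G (x, z) <= G (x, y) * G (y, z).

Definition ratio_class (R : realType) (X : Type) (G : X * X -> R) :
    set (X -> R) :=
  [set f | positive_map f /\ forall x y, f x / f y <= G (x, y)].

(* The supremum is taken in \bar R, since [sup] on R is 0 for an unbounded or
   empty set; equality with a finite value thus entails that the set of ratios
   is nonempty and bounded above. *)
Definition ratio_sup (R : realType) (X : Type) (F : set (X -> R)) (a b : X) :
    \bar R :=
  ereal_sup [set (f a / f b)%:E | f in F].

(* Main.v *)
Require Import Defs.
From mathcomp Require Import all_boot all_order all_algebra.
From mathcomp Require Import all_classical all_reals all_analysis.
Import Order.TTheory GRing.Theory Num.Theory.
Import numFieldNormedType.Exports.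

Local Open Scope classical_set_scope.
Local Open Scope ring_scope.

(** Multiplicatively, [G] is an asymmetric distance, and the theorem is the
    Kuratowski-type description of a distance by its nonexpansive functions.
    The triangle inequality says exactly that each section [G (-, b)] belongs
    to the ratio class of [G] ([section_ratio_class]), and since [G (b, b) = 1]
    this section attains the bound [G (a, b)] on [f a / f b]; so the supremum
    is a maximum.

    Conversely, a pointwise supremum of ratios inherits what each ratio
    satisfies: the cocycle identity [f x / f z = (f x / f y) * (f y / f z)]
    becomes the triangle inequality ([ratio_sup_triangle]), and [f x / f x = 1]
    becomes the value on the diagonal ([ratio_sup_diag]). *)

(** Dividing the triangle inequality for [x, y, b] by [G (y, b)]. *)
Lemma section_ratio_class (R : realType) (X : Type) (G : X * X -> R) (b : X) :
  positive_map G -> mult_triangle G ->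
  ratio_class G (fun x => G (x, b)).
Proof.
move=> Gpos Gtri; split=> [x|x y]; first exact: Gpos.
by rewrite ler_pdivrMr ?Gtri.
Qed.

Lemma ratio_sup_ratio_class (R : realType) (X : Type) (G : X * X -> R)
    (a b : X) :
  positive_map G -> mult_triangle G -> G (b, b) = 1 ->
  ratio_sup (ratio_class G) a b = (G (a, b))%:E.
Proof.
move=> Gpos Gtri Gbb; apply/eqP; rewrite eq_le; apply/andP; split.
  by apply: ge_ereal_sup => _ [f [_ fG] <-]; rewrite lee_fin.
apply: ereal_sup_ubound; exists (fun x => G (x, b)).
  exact: section_ratio_class.
by rewrite /= Gbb divr1.
Qed.

Section RatioSup.
Context (R : realType) (X : Type) (F : set (X -> R)) (G : X * X -> R).
Hypothesis Fpos : forall f, F f -> positive_map f.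
Hypothesis GE : forall a b, (G (a, b))%:E = ratio_sup F a b.

Lemma ratio_le_sup f a b : F f -> f a / f b <= G (a, b).
Proof.
by move=> Ff; rewrite -lee_fin GE; apply: ereal_sup_ubound; exists f.
Qed.

Lemma sup_le_bound a b (c : R) :
  (forall f, F f -> f a / f b <= c) -> G (a, b) <= c.
Proof.
move=> Fc; rewrite -lee_fin GE; apply: ge_ereal_sup => _ [f Ff <-].
by rewrite lee_fin Fc.
Qed.

Lemma ratio_sup_triangle : mult_triangle G.
Proof.
move=> x y z; apply: sup_le_bound => f Ff.
have fpos := Fpos _ Ff.
have -> : f x / f z = (f x / f y) * (f y / f z).
  by rewrite mulrA divfK ?gt_eqF.
by apply: ler_pM; rewrite ?ratio_le_sup ?divr_ge0 ?ltW.
Qed.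

(** Every ratio on the diagonal is [1], and there is at least one: the supremum
    over an empty family is [-oo], whereas [G] is finite. *)
Lemma ratio_sup_diag x : G (x, x) = 1.
Proof.
have [f Ff] : exists f, F f.
  apply/set0P/eqP => F0; have := GE x x.
  by rewrite /ratio_sup F0 image_set0 ereal_sup0.
have ratio1 g : F g -> g x / g x = 1.
  by move=> Fg; rewrite divff // gt_eqF // (Fpos _ Fg).
apply/eqP; rewrite eq_le; apply/andP; split.
  by apply: sup_le_bound => g /ratio1 ->.
by rewrite -(ratio1 f Ff) ratio_le_sup.
Qed.

End RatioSup.

Theorem corollary2 (R : realType) (X : topologicalType) :
  (separable X ->
   forall G : X * X -> R,
     positive_map G ->
     mult_triangle G ->
     (forall x : X, {for (x, x), continuous G}) ->
     (forall x : X, G (x, x) = 1) ->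
     forall a b : X, (G (a, b))%:E = ratio_sup (ratio_class G) a b)
  /\
  (forall (F : set (X -> R)) (G : X * X -> R),
     (forall f, F f -> positive_map f) ->
     positive_map G ->
     (forall a b : X, (G (a, b))%:E = ratio_sup F a b) ->
     [/\ mult_triangle G,
         forall x : X, G (x, x) = 1
       & F `<=` ratio_class G]).
Proof.
split=> [_ G Gpos Gtri _ Gdiag a b|F G Fpos _ GE].
  by rewrite ratio_sup_ratio_class.
split; first exact: ratio_sup_triangle _ _ _ _ Fpos GE.
  exact: ratio_sup_diag _ _ _ _ Fpos GE.
by move=> f Ff; split=> [|x y]; [exact: Fpos | exact: ratio_le_sup _ _ _ _ GE _ _ _ Ff].
Qed.
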